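(* Let $\rho_1:\Gamma\to H$ and $\rho_2:\Gamma\to H$ be fixed point free circle actions of the same group $\Gamma$. Then the following are equivalent: (1) $\rho_1$ is semi-conjugate to $\rho_2$. (2) $\rho_1$ is left-semi-conjugate to $\rho_2$. (3) $\rho_1$ is right-semi-conjugate to $\rho_2$. (4) $\rho_1$ and $\rho_2$ have the same bounded Euler class, i.e. $\rho_1^*\mathrm{eu}_b=\rho_2^*\mathrm{eu}_b\in H^2_b(\Gamma;\mathbb{Z})$.
   Context: $S^1=\mathbb{R}/\mathbb{Z}$; $H=\mathrm{Homeo}^+(S^1)$ is the group of orientation-preserving homeomorphisms of $S^1$. A circle action of a group $\Gamma$ is a homomorphism $\rho:\Gamma\to H$; it is fixed point free if there is no $x\in S^1$ with $\rho(\gamma)(x)=x$ for all $\gamma\in\Gamma$. A map $\varphi:S^1\to S^1$ (not necessarily continuous) is a non-decreasing degree one map if it has a set-theoretic lift $\widetilde\varphi:\mathbb{R}\to\mathbb{R}$ which is non-decreasing and satisfies $\widetilde\varphi(x+1)=\widetilde\varphi(x)+1$ for all $x$. $\rho_1$ is left-semi-conjugate to $\rho_2$ (and $\rho_2$ is right-semi-conjugate to $\rho_1$) if there is a non-decreasing degree one map $\varphi$ with $\rho_1(\gamma)\varphi=\varphi\rho_2(\gamma)$ for all $\gamma\in\Gamma$. $\rho_1$ is semi-conjugate to $\rho_2$ if it is both left- and right-semi-conjugate to $\rho_2$. $\widetilde H=\{\widetilde h\in\mathrm{Homeo}^+(\mathbb{R}): \widetilde h(x+1)=\widetilde h(x)+1\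 \forall x\}$, with central extension $0\to\mathbb{Z}\xrightarrow{i}\widetilde H\xrightarrow{p}H\to\{e\}$, $i(n)(x)=x+n$, $p(\widetilde h)([x])=[\widetilde h(x)]$. $H^2_b(G;\mathbb{Z})$ is the second bounded cohomology of the (discrete) group $G$, computed from bounded inhomogeneous cochains $G^n\to\mathbb{Z}$. Let $\sigma:H\to\widetilde H$ be a section of $p$ with $\{\sigma(h)(0):h\in H\}$ bounded, and define $c_\sigma:H^2\to\mathbb{Z}$ by $\sigma(h_1)\sigma(h_2)=\sigma(h_1h_2)\,i(c_\sigma(h_1,h_2))$. Then $\mathrm{eu}_b:=[c_\sigma]\in H^2_b(H;\mathbb{Z})$ (independent of the bounded section), and the bounded Euler class of $\rho$ is $\rho^*\mathrm{eu}_b$. *)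

(* Defs.v *)
From HB Require Import structures.
From mathcomp Require Import all_boot all_order all_algebra.
From mathcomp Require Import all_classical all_reals topology normedtype realfun.
From mathcomp Require Import zify lra.
Set Implicit Arguments.
Unset Strict Implicit.
Unset Printing Implicit Defensive.
Import Order.TTheory GRing.Theory Num.Theory.
Import numFieldNormedType.Exports.

Local Open Scope ring_scope.

Section Circle.
Variable R : realType.

Definition Zsub : {pred R} := [pred x | x \is a Num.int].

Fact Zsub_zmod_closed : zmod_closed Zsub.
Proof.
by split=> [|x y]; rewrite !inE ?rpred0 // => xZ yZ; rewrite rpredB.
Qed.

HB.instance Definition _ := GRing.isZmodClosed.Build R Zsub Zsub_zmod_closed.

(* Despite its name, {ideal_quot _} only needs an additive subgroup, so this is
   the quotient group R / Z. *)
Definition circle : Type := quotient_topology {ideal_quot Zsub}.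

HB.instance Definition _ :=
  Topological.copy circle (quotient_topology {ideal_quot Zsub}).

Definition to_circle (x : R) : circle :=
  \pi_(quotient_topology {ideal_quot Zsub})%qT x.

Definition of_circle (u : circle) : R :=
  repr (u : quotient_topology {ideal_quot Zsub}).

Lemma of_circleK : cancel of_circle to_circle.
Proof. by move=> u; rewrite /to_circle /of_circle reprK. Qed.

Lemma to_circle_eqP (x y : R) :
  to_circle x = to_circle y <-> exists n : int, x = y + n%:~R.
Proof.
have E : to_circle x = to_circle y <-> (x - y) \is a Num.int.
  by rewrite -[_ \is a Num.int]/(x - y \in Zsub) Quotient.idealrBE;
    split=> [xy|/eqP]; first exact/eqP.
split=> [/E/intrP[n xyn]|[n xyn]]; first by exists n; rewrite -xyn subrKC.
by apply/E; rewrite xyn addrAC subrr add0r intr_int.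
Qed.

Lemma to_circleDz (x : R) (n : int) : to_circle (x + n%:~R) = to_circle x.
Proof. by apply/to_circle_eqP; exists n. Qed.

Lemma to_circle_continuous : continuous to_circle.
Proof. exact: pi_continuous. Qed.

Lemma circle_continuous (T : topologicalType) (f : circle -> T) :
  continuous (f \o to_circle) -> continuous f.
Proof. by move=> ?; apply/quotient_continuous. Qed.

End Circle.

Section HomeoGroup.
Variable T : topologicalType.

Record homeo := Homeo {
  homeo_fun :> T -> T;
  homeo_inv : T -> T;
  homeo_funK : cancel homeo_fun homeo_inv;
  homeo_invK : cancel homeo_inv homeo_fun;
  homeo_fun_continuous : continuous homeo_fun;
  homeo_inv_continuous : continuous homeo_inv }.

HB.instance Definition _ := gen_eqMixin homeo.
HB.instance Definition _ := gen_choiceMixin homeo.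

Lemma homeoP (f g : homeo) : f =1 g -> f = g.
Proof.
case: f g => [f f' fK f'K fc f'c] [g g' gK g'K gc g'c] /= /funext fg.
subst g; have e : f' = g' by apply/funext => x; rewrite -[x in LHS]g'K fK.
by subst g'; congr Homeo; exact: Prop_irrelevance.
Qed.

Definition homeo1 : homeo :=
  @Homeo id id (fun=> erefl) (fun=> erefl)
    (fun=> cvg_id) (fun=> cvg_id).

Definition homeoV (f : homeo) : homeo :=
  Homeo (@homeo_invK f) (@homeo_funK f)
    (@homeo_inv_continuous f) (@homeo_fun_continuous f).

Definition homeoM (f g : homeo) : homeo :=
  @Homeo (f \o g) (homeo_inv g \o homeo_inv f)
    (can_comp (@homeo_funK f) (@homeo_funK g))
    (can_comp (@homeo_invK g) (@homeo_invK f))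
    (fun x => continuous_comp (@homeo_fun_continuous g x)
                (@homeo_fun_continuous f (g x)))
    (fun x => continuous_comp (@homeo_inv_continuous f x)
                (@homeo_inv_continuous g (homeo_inv f x))).

Fact homeoMA : associative homeoM.
Proof. by move=> f g h; exact: homeoP. Qed.
Fact homeo1M : left_id homeo1 homeoM.
Proof. by move=> f; exact: homeoP. Qed.
Fact homeoM1 : right_id homeo1 homeoM.
Proof. by move=> f; exact: homeoP. Qed.
Fact homeoVM : left_inverse homeo1 homeoV homeoM.
Proof. by move=> f; apply: homeoP => x; exact: homeo_funK. Qed.
Fact homeoMV : right_inverse homeo1 homeoV homeoM.
Proof. by move=> f; apply: homeoP => x; exact: homeo_invK. Qed.

HB.instance Definition _ :=
  isGroup.Build homeo homeoMA homeo1M homeoM1 homeoVM homeoMV.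

End HomeoGroup.

Section Groups.
Variable R : realType.

Definition degree_one_homeo : {pred homeo R} :=
  [pred f : homeo R | `[< {homo f : x y / x < y} /\ forall x, f (x + 1) = f x + 1 >]].

Fact degree_one_homeo_group_closed : group_closed degree_one_homeo.
Proof.
split=> [|f g]; first by apply/asboolP; split.
move=> /asboolP[fi f1] /asboolP[gi g1]; apply/asboolP.
have g'i : {homo homeo_inv g : x y / x < y}.
  move=> x y xy; rewrite ltNge; apply/negP => h; have := lt_geF xy.
  have := ltW_homo gi; move=> /(_ _ _ h); by rewrite !homeo_invK => ->.
split=> [x y xy|x] /=; first by apply: fi; apply: g'i.
rewrite -f1; congr (homeo_fun f _); apply: (can_inj (@homeo_funK _ g)).
by rewrite g1 !homeo_invK.
Qed.

Record line_homeo := LineHomeo {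
  line_homeo_val :> homeo R;
  line_homeo_valP : line_homeo_val \in degree_one_homeo }.

HB.instance Definition _ := [isSub of line_homeo for line_homeo_val].
HB.instance Definition _ := [Choice of line_homeo by <:].
HB.instance Definition _ :=
  SubChoice_isSubGroup.Build _ _ line_homeo degree_one_homeo_group_closed.

(* A homeomorphism of the circle preserves the orientation when it has an
   increasing continuous lift to the line. *)
Definition orientation_preserving : {pred homeo (circle R)} :=
  [pred h : homeo (circle R) | `[< exists f : R -> R,
    [/\ continuous f, {homo f : x y / x < y} &
        forall x, to_circle (f x) = h (to_circle x)] >]].

Lemma line_homeo_incr (f : line_homeo) : {homo f : x y / x < y}.
Proof. by have /asboolP[] := line_homeo_valP f. Qed.

Lemma line_homeo1 (f : line_homeo) x : f (x + 1) = f x + 1.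
Proof. by have /asboolP[] := line_homeo_valP f. Qed.

Lemma translate_int (f : R -> R) : (forall x, f (x + 1) = f x + 1) ->
  forall x (n : int), f (x + n%:~R) = f x + n%:~R.
Proof.
move=> f1; have fn x (n : nat) : f (x + n%:R) = f x + n%:R.
  by elim: n => [|n IH]; rewrite ?addr0 // -natr1 !addrA f1 IH.
move=> x [n|n]; first exact: fn.
by rewrite NegzE mulrNz; apply: (addIr n.+1%:R); rewrite -fn !subrK.
Qed.

Lemma line_homeoDz (f : line_homeo) x (n : int) : f (x + n%:~R) = f x + n%:~R.
Proof. exact/translate_int/line_homeo1. Qed.

Lemma line_homeoP (f g : line_homeo) : f =1 g -> f = g.
Proof. by move=> fg; apply/val_inj/homeoP. Qed.

Lemma incr_lift_line_homeo (h : homeo (circle R)) (f : R -> R) :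
    continuous f -> {homo f : x y / x < y} ->
    (forall x, to_circle (f x) = h (to_circle x)) ->
  exists g : line_homeo, g =1 f.
Proof.
move=> fc fi fh.
have fI : injective f.
  move=> x y; case: (ltgtP x y) => // /fi; first by move=> + e; rewrite e ltxx.
  by move=> + e; rewrite e ltxx.
have lef : {mono f : x y / x <= y} by exact: le_mono.
have f1 x : f (x + 1) = f x + 1.
  have : to_circle (f (x + 1)) = to_circle (f x).
    by rewrite !fh (to_circleDz x 1).
  move=> /to_circle_eqP[n fn]; have xx1 : x < x + 1 by rewrite ltrDl.
  have n0 : (0 < n)%R by have := fi _ _ xx1; rewrite fn ltrDl ltr0z.
  have [n1|n1] := leP n 1.
    by rewrite fn (_ : n = 1) //; clear -n0 n1; lia.
  have [] := @IVT R f x (x + 1) (f x + 1) (ltW xx1).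
  - by apply: continuous_subspaceT => ?; exact: fc.
  - rewrite minEle maxEle (ltW (fi _ _ xx1)) lerDl ler01 fn lerD2l.
    by rewrite (ler_int _ 1) ltW.
  - move=> c /[!in_itv]/= /andP[xc cx] fcE.
    have : to_circle c = to_circle x.
      by apply: (can_inj (@homeo_funK _ h)); rewrite -!fh fcE (to_circleDz _ 1).
    move=> /to_circle_eqP[m cE]; subst c; move: xc cx.
    rewrite lerDl lerD2l (ler_int _ m 1) ler0z => m0 m1.
    have m01 : m = 0 \/ m = 1 by clear -m0 m1; lia.
    case: m01 => mE; subst m; move: fcE.
      by rewrite addr0 => /eqP; rewrite eq_sym -subr_eq0 addrAC subrr add0r oner_eq0.
    rewrite fn => /addrI/eqP; rewrite (eqr_int _ n 1) => /eqP nE; by rewrite nE in n1.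
have fz := translate_int f1.
have fsurj y : exists x, f x = y.
  set n := Num.floor (y - f 0).
  have /andP[ny yn] := floor_itv (y - f 0).
  have fn : f n%:~R = f 0 + n%:~R by rewrite -fz add0r.
  have [] := @IVT R f n%:~R (n%:~R + 1) y.
  - by rewrite lerDl.
  - by apply: continuous_subspaceT => ?; exact: fc.
  - rewrite f1 fn minEle maxEle lerDl ler01.
    rewrite -lerBrDl ny /= -addrA -lerBlDl; apply: ltW.
    by move: yn; rewrite intrD.
  - by move=> c _ fcE; exists c.
pose g y := projT1 (cid (fsurj y)).
have gK : cancel g f by move=> y; rewrite /g; case: cid.
have fK : cancel f g by move=> x; apply: fI; rewrite gK.
have gc : continuous g.
  move=> y; rewrite -[y]gK.
  apply: (nbhs_singleton (near_can_continuous _ _)); apply: filterE => z.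
    exact: fK.
  exact: fc.
pose F := Homeo fK gK fc gc.
have FP : F \in degree_one_homeo by apply/asboolP.
by exists (LineHomeo FP).
Qed.

Fact orientation_preserving_group_closed : group_closed orientation_preserving.
Proof.
split=> [|h k]; first by apply/asboolP; exists id; split=> // x; exact: cvg_id.
move=> /asboolP[f [fc fi fh]] /asboolP[g [gc gi gk]]; apply/asboolP.
have [F FE] := incr_lift_line_homeo fc fi fh.
have [G GE] := incr_lift_line_homeo gc gi gk.
exists (F / G)%g; split=> [||x].
- exact: homeo_fun_continuous.
- exact: line_homeo_incr.
- rewrite /= FE fh; congr (homeo_fun h _).
  apply: (can_inj (@homeo_funK _ k)); rewrite homeo_invK -gk -GE.
  by rewrite homeo_invK.
Qed.

Record circle_homeo := CircleHomeo {
  circle_homeo_val :> homeo (circle R);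
  circle_homeo_valP : circle_homeo_val \in orientation_preserving }.

HB.instance Definition _ := [isSub of circle_homeo for circle_homeo_val].
HB.instance Definition _ := [Choice of circle_homeo by <:].
HB.instance Definition _ :=
  SubChoice_isSubGroup.Build _ _ circle_homeo
    orientation_preserving_group_closed.

Lemma circle_homeoP (f g : circle_homeo) : f =1 g -> f = g.
Proof. by move=> fg; apply/val_inj/homeoP. Qed.

Lemma circle_homeoME (f g : circle_homeo) u : (f * g)%g u = f (g u).
Proof. by []. Qed.

Lemma line_homeoME (f g : line_homeo) x : (f * g)%g x = f (g x).
Proof. by []. Qed.

Fact descend_subproof (f : homeo R) (f1 : f \in degree_one_homeo) x :
  to_circle (f (of_circle (to_circle x))) = to_circle (f x).
Proof.
have /to_circle_eqP[n ->] : to_circle (of_circle (to_circle x)) = to_circle x.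
  by rewrite of_circleK.
by rewrite (line_homeoDz (LineHomeo f1)) to_circleDz.
Qed.

Definition descend_fun (f : homeo R) (u : circle R) : circle R :=
  to_circle (f (of_circle u)).

Fact descend_cancel (f g : homeo R) :
    f \in degree_one_homeo -> g \in degree_one_homeo -> cancel f g ->
  cancel (descend_fun f) (descend_fun g).
Proof.
move=> fP gP fK u; rewrite /descend_fun descend_subproof // fK.
exact: of_circleK.
Qed.

Fact descend_continuous (f : homeo R) :
  f \in degree_one_homeo -> continuous (descend_fun f).
Proof.
move=> fP; apply: circle_continuous.
have -> : descend_fun f \o @to_circle R = @to_circle R \o f.
  by apply/funext => x /=; exact: descend_subproof.
move=> x; apply: continuous_comp; first exact: homeo_fun_continuous.
exact: to_circle_continuous.
Qed.

(* The projection p of the central extension 0 -> Z -> line_homeo ->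
   circle_homeo -> 1 is descend; the inclusion of Z is translation; exactness
   is descend_surj, descend_eqP and translation_inj. *)
Definition descend_homeo (f : line_homeo) : homeo (circle R) :=
  Homeo
    (descend_cancel (line_homeo_valP f) (line_homeo_valP f^-1)%g
       (@homeo_funK _ f))
    (descend_cancel (line_homeo_valP f^-1)%g (line_homeo_valP f)
       (@homeo_invK _ f))
    (descend_continuous (line_homeo_valP f))
    (descend_continuous (line_homeo_valP f^-1)%g).

Fact descend_homeo_op (f : line_homeo) :
  descend_homeo f \in orientation_preserving.
Proof.
apply/asboolP; exists f; split=> [||x].
- exact: homeo_fun_continuous.
- exact: line_homeo_incr.
- by rewrite /= /descend_fun descend_subproof // line_homeo_valP.
Qed.

Definition descend (f : line_homeo) : circle_homeo :=
  CircleHomeo (descend_homeo_op f).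

Lemma descendE (f : line_homeo) x : descend f (to_circle x) = to_circle (f x).
Proof. by rewrite /= /descend_fun descend_subproof // line_homeo_valP. Qed.

Fact descendM : {morph descend : f g / (f * g)%g}.
Proof.
move=> f g; apply: circle_homeoP => u; rewrite -[u]of_circleK.
by rewrite circle_homeoME !descendE.
Qed.

HB.instance Definition _ := isMultiplicative.Build _ _ descend descendM.

Lemma descend_surj (h : circle_homeo) : exists f, descend f = h.
Proof.
have /asboolP[f [fc fi fh]] := circle_homeo_valP h.
have [F FE] := incr_lift_line_homeo fc fi fh; exists F.
by apply: circle_homeoP => u; rewrite -[u]of_circleK descendE FE fh.
Qed.

Definition translation_homeo (n : int) : homeo R :=
  @Homeo R (fun x : R => x + n%:~R) (fun x : R => x - n%:~R)
    (addrK _) (subrK _)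
    (fun x => continuousD cvg_id (cvg_cst _))
    (fun x => continuousB cvg_id (cvg_cst _)).

Fact translation_degree_one n : translation_homeo n \in degree_one_homeo.
Proof.
by apply/asboolP; split=> [x y|x] /=; rewrite ?ltrD2r // addrAC.
Qed.

Definition translation (n : int) : line_homeo :=
  LineHomeo (translation_degree_one n).

Lemma translationD m n :
  translation (m + n) = (translation m * translation n)%g.
Proof.
by apply: line_homeoP => x; rewrite /= intrD addrA addrAC.
Qed.

Lemma translation_central n (f : line_homeo) :
  (translation n * f = f * translation n)%g.
Proof. by apply: line_homeoP => x; rewrite !line_homeoME /= line_homeoDz. Qed.

Lemma descend_eqP (f g : line_homeo) :
  descend f = descend g <-> exists n, f = (g * translation n)%g.
Proof.
split=> [fg|[n ->]]; last first.
  apply: circle_homeoP => u; rewrite -[u]of_circleK !descendE line_homeoME /=.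
  by rewrite line_homeoDz to_circleDz.
have hz x : exists n : int, f x = g x + n%:~R.
  by apply/to_circle_eqP; rewrite -!descendE fg.
have hg x : exists n : int, f x = g (x + n%:~R).
  by have [n fx] := hz x; exists n; rewrite line_homeoDz.
have ltg : {mono g : x y / x < y}.
  exact/leW_mono/le_mono/line_homeo_incr.
have [n f0] := hg 0; exists n.
have main y : 0 <= y < 1 -> f y = g (y + n%:~R).
  move=> /andP[y0 y1]; have [m fy] := hg y.
  have h1 : y + m%:~R < 1 + n%:~R.
    have := line_homeo_incr f y1.
    by rewrite fy -[in f 1](add0r 1) line_homeo1 f0 -line_homeo1 ltg add0r [ltRHS]addrC.
  have mn : m < n + 1.
    rewrite -(ltr_int R) intrD [ltRHS]addrC.
    by apply: le_lt_trans h1; rewrite lerDr.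
  have nm : n <= m.
    move: y0; rewrite le_eqVlt => /predU1P[y0|y0].
      have := fy; rewrite -y0 f0 => /(can_inj (@homeo_funK _ g)) /addrI /eqP.
      by rewrite eqr_int => /eqP ->.
    have := line_homeo_incr f y0; rewrite f0 fy ltg add0r => h2.
    have : n < m + 1.
      rewrite -(ltr_int R) intrD [ltRHS]addrC.
      by apply: lt_trans h2 _; rewrite ltrD2r.
    by clear; lia.
  by rewrite fy (_ : m = n) //; clear -mn nm; lia.
apply: line_homeoP => x; rewrite line_homeoME /=.
have /andP[xl xr] := floor_itv x.
rewrite -[x](subrK (Num.floor x)%:~R) line_homeoDz main.
  by rewrite -line_homeoDz addrAC.
by rewrite subr_ge0 xl ltrBlDl; move: xr; rewrite intrD.
Qed.

End Groups.

Section BoundedCohomology.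
Variable G : groupType.

(* Inhomogeneous cochains with trivial coefficients Z: cobound1 and cobound2
   are the coboundary operators C^1 -> C^2 and C^2 -> C^3. *)
Definition bounded_cochain (X : Type) (c : X -> int) : Prop :=
  exists M : int, forall x, `|c x| <= M.

Definition cobound1 (b : G -> int) (x : G * G) : int :=
  b x.2 - b (x.1 * x.2)%g + b x.1.

Definition cobound2 (c : G * G -> int) (x : G * G * G) : int :=
  let: (g, h, k) := x in
  c (h, k) - c ((g * h)%g, k) + c (g, (h * k)%g) - c (g, h).

Definition is_bcocycle2 : {pred G * G -> int} :=
  [pred c | `[< bounded_cochain c /\ forall x, cobound2 c x = 0 >]].

Lemma bounded_cochain0 X : bounded_cochain (0 : X -> int).
Proof. by exists 0 => x; rewrite normr0. Qed.

Lemma bounded_cochainB X (c d : X -> int) :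
  bounded_cochain c -> bounded_cochain d -> bounded_cochain (c - d).
Proof.
move=> [M cM] [N dN]; exists (M + N) => x.
by rewrite (le_trans (ler_normB _ _)) // lerD.
Qed.

Fact is_bcocycle2_zmod_closed : zmod_closed is_bcocycle2.
Proof.
split=> [|c d].
  by apply/asboolP; split; [exact: bounded_cochain0 | move=> [[g h] k]].
move=> /asboolP[cb c0] /asboolP[db d0]; apply/asboolP.
split; first exact: bounded_cochainB.
move=> [[g h] k]; have := c0 (g, h, k); have := d0 (g, h, k).
rewrite /cobound2 !fctE /=.
by lia.
Qed.

Record bcocycle2 := BCocycle2 {
  bcocycle2_val :> G * G -> int;
  bcocycle2_valP : bcocycle2_val \in is_bcocycle2 }.

HB.instance Definition _ := [isSub of bcocycle2 for bcocycle2_val].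
HB.instance Definition _ := [Choice of bcocycle2 by <:].
HB.instance Definition _ :=
  GRing.SubChoice_isSubZmodule.Build _ _ bcocycle2 is_bcocycle2_zmod_closed.

Lemma bcocycle2BE (c d : bcocycle2) x : (c - d) x = c x - d x.
Proof. by rewrite -[LHS]/(val (c - d) x) raddfB. Qed.

Definition is_bcobound2 : {pred bcocycle2} :=
  [pred c : bcocycle2 | `[< exists2 b : G -> int, bounded_cochain b &
                            bcocycle2_val c = cobound1 b >]].

Fact is_bcobound2_zmod_closed : zmod_closed is_bcobound2.
Proof.
split=> [|c d].
  apply/asboolP; exists 0; first exact: bounded_cochain0.
  by apply/funext => x.
move=> /asboolP[b bb cE] /asboolP[e eb dE]; apply/asboolP.
exists (b - e); first exact: bounded_cochainB.
apply/funext => x; rewrite bcocycle2BE cE dE /cobound1 !fctE /=.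
by lia.
Qed.

HB.instance Definition _ :=
  GRing.isZmodClosed.Build bcocycle2 is_bcobound2 is_bcobound2_zmod_closed.

Definition H2b : zmodType := {ideal_quot is_bcobound2}.

Definition H2b_class (c : bcocycle2) : H2b :=
  \pi_({ideal_quot is_bcobound2})%qT c.

Lemma H2b_class_eqP (c d : bcocycle2) :
  H2b_class c = H2b_class d <->
  exists2 b : G -> int, bounded_cochain b &
    forall x, c x - d x = cobound1 b x.
Proof.
have E : H2b_class c = H2b_class d <-> c - d \in is_bcobound2.
  by rewrite Quotient.idealrBE; split=> [cd|/eqP]; first exact/eqP.
split=> [/E/asboolP[b bb cdE]|[b bb cdE]].
  by exists b => // x; rewrite -cdE bcocycle2BE.
by apply/E/asboolP; exists b => //; apply/funext => x; rewrite -cdE bcocycle2BE.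
Qed.

End BoundedCohomology.

Section Pullback.
Variables (G H : groupType) (f : {multiplicative G -> H}).

Fact pullback_subproof (c : bcocycle2 H) :
  (fun x : G * G => c (f x.1, f x.2)) \in @is_bcocycle2 G.
Proof.
have /asboolP[[M cM] c0] := bcocycle2_valP c; apply/asboolP; split.
  by exists M => x; exact: cM.
by move=> [[g h] k] /=; rewrite !gmulfM; exact: (c0 (f g, f h, f k)).
Qed.

Definition bcocycle2_pullback (c : bcocycle2 H) : bcocycle2 G :=
  BCocycle2 (pullback_subproof c).

(* f^* : H^2_b(H; Z) -> H^2_b(G; Z) *)
Definition H2b_pullback (u : H2b H) : H2b G :=
  H2b_class (bcocycle2_pullback (repr (u : {ideal_quot @is_bcobound2 H}))).

Lemma H2b_pullbackE (c : bcocycle2 H) :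
  H2b_pullback (H2b_class c) = H2b_class (bcocycle2_pullback c).
Proof.
have : H2b_class (repr (H2b_class c : {ideal_quot @is_bcobound2 H})) =
       H2b_class c by rewrite /H2b_class reprK.
move=> /H2b_class_eqP[b [M bM] cE]; apply/H2b_class_eqP.
exists (b \o f); first by exists M => x; exact: bM.
by move=> [g h]; rewrite /cobound1 /= gmulfM; exact: (cE (f g, f h)).
Qed.

End Pullback.

Section EulerClass.
Variable R : realType.
Local Notation H := (circle_homeo R).
Local Notation Ht := (line_homeo R).

Record bounded_section := BoundedSection {
  bsection :> H -> Ht;
  bsectionK : cancel bsection (@descend R);
  bsection_bounded : exists M : R, forall h, `|bsection h 0| <= M }.

(* The integer n with s(g) s(h) = s(gh) i(n), see euler_cochainE; the default
   value 0 is never taken when s is a section. *)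
Definition euler_cochain (s : H -> Ht) (x : H * H) : int :=
  xget 0 [set n : int |
    (s x.1 * s x.2 = s (x.1 * x.2) * translation R n)%g]%classic.

Lemma euler_cochainE (s : H -> Ht) : cancel s (@descend R) ->
  forall g h, (s g * s h = s (g * h) * translation R (euler_cochain s (g, h)))%g.
Proof.
move=> sK g h.
suff: exists n, (s g * s h = s (g * h) * translation R n)%g.
  exact: xgetPex.
have: descend (s g * s h)%g = descend (s (g * h)%g) by rewrite descendM !sK.
by move=> /descend_eqP.
Qed.

Lemma translation_inj : injective (@translation R).
Proof.
move=> m n mn; have := congr1 (fun f : Ht => f 0) mn.
by rewrite /= !add0r => /eqP; rewrite eqr_int => /eqP.
Qed.

Lemma line_homeo_bound (f : Ht) (M x : R) : `|f 0| <= M -> `|x| <= M ->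
  `|f x| <= M + M + 1.
Proof.
have lef : {homo f : x y / x <= y} by apply/ltW_homo/line_homeo_incr.
rewrite !ler_norml => /andP[f0l f0r] /andP[xl xr].
have /andP[nl nr] := floor_itv x; set n := Num.floor x in nl nr.
have fn (m : int) : f m%:~R = f 0 + m%:~R by rewrite -line_homeoDz add0r.
have := lef _ _ nl; have := lef _ _ (ltW nr); rewrite !fn => h1 h2.
rewrite intrD in nr h1; apply/andP; split; lra.
Qed.

Fact euler_cochain_bcocycle2 (s : bounded_section) :
  euler_cochain s \in @is_bcocycle2 H.
Proof.
have sK := @bsectionK s.
apply/asboolP; split.
  have [M sM] := bsection_bounded s.
  have [N MN] : exists N : int, M + M + 1 + M <= N%:~R.
    exists (Num.ceil (M + M + 1 + M)); exact: ceil_ge.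
  exists N => -[g h].
  have := congr1 (fun f : Ht => f 0) (euler_cochainE sK g h).
  rewrite !line_homeoME /= add0r -[X in s (g * h)%g X]add0r line_homeoDz => E.
  rewrite -(ler_int R) intr_norm.
  have -> : (euler_cochain s (g, h))%:~R = s g (s h 0) - s (g * h)%g 0.
    by rewrite E addrAC subrr add0r.
  apply: le_trans (ler_normB _ _) _; apply: le_trans MN.
  by apply: lerD => //; exact: line_homeo_bound.
move=> [[g h] k]; set c := euler_cochain s.
have E : translation R (c ((g * h)%g, k) + c (g, h)) =
         translation R (c (g, (h * k)%g) + c (h, k)).
  have e1 := euler_cochainE sK (g * h)%g k.
  have e2 := euler_cochainE sK g h.
  have e3 := euler_cochainE sK g (h * k)%g.
  have e4 := euler_cochainE sK h k.
  rewrite -!/c in e1 e2 e3 e4; apply: (mulgI (s (g * h * k)%g)).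
  transitivity (s g * s h * s k)%g.
    by rewrite translationD mulgA -e1 -mulgA -translation_central mulgA -e2.
  by rewrite translationD mulgA -(mulgA g h k) -e3 -!mulgA -e4.
by move: (translation_inj E); rewrite /cobound2; lia.
Qed.

Definition euler_cocycle (s : bounded_section) : bcocycle2 H :=
  BCocycle2 (euler_cochain_bcocycle2 s).

Lemma euler_class_indep (s t : bounded_section) :
  H2b_class (euler_cocycle s) = H2b_class (euler_cocycle t).
Proof.
have sK := @bsectionK s; have tK := @bsectionK t.
have hb h : exists n, s h = (t h * translation R n)%g.
  by apply/(descend_eqP (s h) (t h)); rewrite sK tK.
pose b h := projT1 (cid (hb h)).
have bE h : s h = (t h * translation R (b h))%g by rewrite /b; case: cid.
apply/H2b_class_eqP; exists b.
  have [M sM] := bsection_bounded s; have [N tN] := bsection_bounded t.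
  exists (Num.ceil (M + N)) => h; rewrite -(ler_int R) intr_norm.
  apply: le_trans (ceil_ge _).
  have := congr1 (fun f : Ht => f 0) (bE h).
  rewrite line_homeoME /= add0r -[X in t h X]add0r line_homeoDz => E.
  have -> : (b h)%:~R = s h 0 - t h 0 by rewrite E addrAC subrr add0r.
  by rewrite (le_trans (ler_normB _ _)) // lerD.
move=> [g h]; rewrite /cobound1 /=.
set cs := euler_cochain s (g, h); set ct := euler_cochain t (g, h).
have E : translation R (b (g * h)%g + cs) = translation R (ct + (b g + b h)).
  apply: (mulgI (t (g * h)%g)).
  have e1 := euler_cochainE sK g h; have e2 := euler_cochainE tK g h.
  rewrite -!/cs in e1; rewrite -!/ct in e2.
  rewrite !translationD mulgA -bE -e1 mulgA -e2 !bE -!mulgA.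
  by congr (_ * _)%g; rewrite !mulgA translation_central.
by move: (translation_inj E); lia.
Qed.

Lemma normalized_lift (h : H) : exists f : Ht, descend f = h /\ 0 <= f 0 < 1.
Proof.
have [f fh] := descend_surj h.
exists (f * translation R (- Num.floor (f 0)))%g; split.
  by rewrite -fh; apply/(descend_eqP _ f); eexists.
rewrite line_homeoME /= line_homeoDz mulrNz.
have /andP[fl fr] := floor_itv (f 0).
by rewrite subr_ge0 fl ltrBlDl -(intrD _ _ 1).
Qed.

(* The section whose lifts satisfy 0 <= s(h)(0) < 1. *)
Definition normalized_section_fun (h : H) : Ht := projT1 (cid (normalized_lift h)).

Fact normalized_section_funK : cancel normalized_section_fun (@descend R).
Proof. by move=> h; rewrite /normalized_section_fun; case: cid => f []. Qed.

Fact normalized_section_fun_bounded :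
  exists M : R, forall h, `|normalized_section_fun h 0| <= M.
Proof.
exists 1 => h; rewrite /normalized_section_fun; case: cid => f /= [_ /andP[f0 f1]].
by rewrite ger0_norm // ltW.
Qed.

Definition normalized_section : bounded_section :=
  BoundedSection normalized_section_funK normalized_section_fun_bounded.

(* By eu_bE the class does not depend on the bounded section. *)
Definition eu_b : H2b H := H2b_class (euler_cocycle normalized_section).

Lemma eu_bE (s : bounded_section) : eu_b = H2b_class (euler_cocycle s).
Proof. exact: euler_class_indep. Qed.

End EulerClass.

Section CircleActions.
Variables (R : realType) (Gam : groupType).
Implicit Types rho : {multiplicative Gam -> circle_homeo R}.

Definition fixed_point_free rho : Prop :=
  ~ exists x : circle R, forall g, rho g x = x.

Definition nondecreasing_degree_one (phi : circle R -> circle R) : Prop :=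
  exists f : R -> R,
    [/\ {homo f : x y / x <= y}, forall x, f (x + 1) = f x + 1 &
        forall x, phi (to_circle x) = to_circle (f x)].

Definition left_semi_conjugate rho1 rho2 : Prop :=
  exists2 phi : circle R -> circle R, nondecreasing_degree_one phi &
    forall g, rho1 g \o phi = phi \o rho2 g.

Definition right_semi_conjugate rho1 rho2 : Prop := left_semi_conjugate rho2 rho1.

Definition semi_conjugate rho1 rho2 : Prop :=
  left_semi_conjugate rho1 rho2 /\ right_semi_conjugate rho1 rho2.

Definition bounded_euler_class rho : H2b Gam := H2b_pullback rho (eu_b R).

End CircleActions.

(* Main.v *)
(** If two families of lifts [t1, t2] of the actions have the same cocycle and
    are bounded at [0], then [f x = sup_g (t1 g)^-1 (t2 g x)] is a nondecreasing
    degree one map with [t1 h \o f = f \o t2 h]: reindexing the supremum by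
    [g |-> g * h] cancels the two cocycles.  Conversely, given an equivariant
    [phi] with lift [f], the maps [t1 g \o f] and [f \o t2 g] lift the same
    circle map.  Two nondecreasing degree one lifts of one map differ by a
    constant integer unless that map is constant, and a constant [phi] would be
    a fixed point; these integers cobound the difference of the two cocycles. *)
Require Import Defs.
From HB Require Import structures.
From mathcomp Require Import all_boot all_order all_algebra.
From mathcomp Require Import all_classical all_reals.
From mathcomp Require Import zify lra.
Set Implicit Arguments.
Unset Strict Implicit.
Unset Printing Implicit Defensive.
Import Order.TTheory GRing.Theory Num.Theory.

Local Open Scope ring_scope.

Section DegreeOne.
Variable R : realType.
Implicit Types (f F G : R -> R) (t : line_homeo R).

Lemma line_homeo_mono t : {mono t : x y / x <= y}.
Proof. exact/le_mono/line_homeo_incr. Qed.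

Lemma line_homeo_int t (n : int) : t n%:~R = t 0 + n%:~R.
Proof. by rewrite -line_homeoDz add0r. Qed.

(** On [[0, 1]] both [F] and [G + n0] stay in [[F 0, F 0 + 1]], so they differ by [0], [1] or [-1].
    A nonzero difference at some [y] puts them at opposite ends of that interval; monotonicity then
    confines [F] to the two end values, which are one point of the circle. *)
Lemma lifts_eq_or_const F G :
    {homo F : x y / x <= y} -> (forall x, F (x + 1) = F x + 1) ->
    {homo G : x y / x <= y} -> (forall x, G (x + 1) = G x + 1) ->
    (forall x, to_circle (F x) = to_circle (G x)) ->
  (exists n : int, forall x, F x = G x + n%:~R) \/
  (forall x, to_circle (F x) = to_circle (F 0)).
Proof.
move=> Fle F1 Gle G1 FG.
have Fz := translate_int F1; have Gz := translate_int G1.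
have [n0 F0] : exists n : int, F 0 = G 0 + n%:~R by exact/to_circle_eqP.
have red (P : R -> Prop) : (forall x (n : int), P x -> P (x + n%:~R)) ->
    (forall x, 0 <= x <= 1 -> P x) -> forall x, P x.
  move=> Pz P01 x; have /andP[xl xr] := floor_itv x.
  rewrite -[x](subrK (Num.floor x)%:~R); apply/Pz/P01.
  by rewrite subr_ge0 xl lerBlDl ltW //; move: xr; rewrite intrD.
have FE x (k : int) : F x = F 0 + k%:~R -> to_circle (F x) = to_circle (F 0).
  by move=> ->; exact: to_circleDz.
have [[y [y01 yn]]|neq] :=
    pselect (exists y, 0 <= y <= 1 /\ F y != G y + n0%:~R); last first.
  left; exists n0; apply: red => [x n e|x x01]; first by rewrite Fz Gz e addrAC.
  by apply/eqP/negPn/negP => xn; apply: neq; exists x.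
right; apply: red => [x n <-|x /andP[x0 x1]]; first by rewrite Fz to_circleDz.
have bound z : 0 <= z <= 1 ->
    F 0 <= F z <= F 0 + 1 /\ F 0 <= G z + n0%:~R <= F 0 + 1.
  move=> /andP[z0 z1]; have := Fle _ _ z0; have := Fle _ _ z1.
  have := Gle _ _ z0; have := Gle _ _ z1.
  have := F1 0; have := G1 0; rewrite add0r => -> ->.
  by move=> *; split; lra.
have diff z : 0 <= z <= 1 -> exists2 k : int, F z = G z + n0%:~R + k%:~R &
    [\/ k = 0, k%:~R = 1 :> R | k%:~R = -1 :> R].
  move=> /bound[b1 b2]; have /to_circle_eqP[l Fz'] := FG z.
  have Fzk : F z = G z + n0%:~R + (l - n0)%:~R by rewrite intrB; lra.
  exists (l - n0) => //; move: (l - n0) Fzk => k Fzk.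
  have kle : (k%:~R : R) <= 1%:~R by lra.
  have kge : ((-1)%:~R : R) <= k%:~R by rewrite rmorphN; lra.
  move: kle kge; rewrite !ler_int => kle kge.
  have /orP[/orP[]|] : (k == 0) || (k == 1) || (k == -1).
  - by clear -kle kge; lia.
  - by move=> /eqP ->; apply: Or31.
  - by move=> /eqP ->; apply: Or32.
  - by move=> /eqP ->; apply: Or33.
have x01 : 0 <= x <= 1 by rewrite x0.
have [by1 by2] := bound _ y01; have [bx1 bx2] := bound _ x01.
have [m Fy mR] := diff _ y01; have [k Fx kR] := diff _ x01.
suff [->|] : F x = F 0 \/ F x = F 0 + 1 by [|exact: (FE x 1)].
case: kR => [k0|k1|k1]; [|by right; lra|by left; lra].
(* The maps agree at [x]. If [x <= y], the one at the bottom end at [y] forces the bottom value; if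
   [y <= x], the one at the top end forces the top value. *)
rewrite k0 addr0 in Fx.
case: mR => [m0|mR|mR]; first by rewrite Fy m0 addr0 eqxx in yn.
all: rewrite mR in Fy.
all: by have [/[dup] xy /Fle Fxy|/ltW /[dup] yx /Fle Fyx] := leP x y;
  [have := Gle _ _ xy|have := Gle _ _ yx]; (left; lra) || (right; lra).
Qed.

End DegreeOne.

Section EulerSemiConj.
Variables (R : realType) (Gam : groupType).
Implicit Types rho : {multiplicative Gam -> circle_homeo R}.

Local Notation s := (normalized_section R).

Lemma normalized_sectionE (h : circle_homeo R) : 0 <= s h 0 < 1.
Proof. by rewrite /= /normalized_section_fun; case: cid => f []. Qed.

Lemma normalized_sectionM rho g h x :
  s (rho g) (s (rho h) x) =
  s (rho (g * h)%g) x + (euler_cochain s (rho g, rho h))%:~R.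
Proof.
have := euler_cochainE (@bsectionK _ s) (rho g) (rho h).
move=> /(congr1 (fun t : line_homeo R => t x)).
by rewrite gmulfM !line_homeoME /= line_homeoDz.
Qed.

Lemma bounded_euler_class_eqP rho1 rho2 :
  bounded_euler_class rho1 = bounded_euler_class rho2 <->
  exists2 b : Gam -> int, bounded_cochain b & forall g h,
    euler_cochain s (rho1 g, rho1 h) - euler_cochain s (rho2 g, rho2 h) =
    b h - b (g * h)%g + b g.
Proof.
rewrite /bounded_euler_class /eu_b !H2b_pullbackE; split.
  by move=> /H2b_class_eqP[b bb E]; exists b => // g h; exact: (E (g, h)).
by move=> [b bb E]; apply/H2b_class_eqP; exists b => // -[g h]; exact: E.
Qed.

Lemma left_semi_conjugate_euler rho1 rho2 : fixed_point_free rho1 ->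
  left_semi_conjugate rho1 rho2 ->
  bounded_euler_class rho1 = bounded_euler_class rho2.
Proof.
move=> fpf [phi [f [fle f1 fphi]] eqv]; apply/bounded_euler_class_eqP.
have fz := translate_int f1.
have lift g x : to_circle (s (rho1 g) (f x)) = to_circle (f (s (rho2 g) x)).
  rewrite -descendE bsectionK -!fphi -descendE bsectionK.
  exact: (congr1 (fun u => u (to_circle x)) (eqv g)).
have hn g : exists n : int, forall x,
    s (rho1 g) (f x) = f (s (rho2 g) x) + n%:~R.
  have [|||||//|cst] := lifts_eq_or_const (F := s (rho1 g) \o f)
    (G := f \o s (rho2 g)).
  - by move=> x y xy /=; rewrite line_homeo_mono fle.
  - by move=> x /=; rewrite f1 line_homeo1.
  - by move=> x y xy /=; rewrite fle // line_homeo_mono.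
  - by move=> x /=; rewrite line_homeo1 f1.
  - exact: lift.
  (* By [cst], [rho1 g \o phi] is constant, and [rho1 g] is injective. *)
  have phic u : phi u = phi (to_circle 0).
    apply: (can_inj (@homeo_funK _ (rho1 g))).
    rewrite -[u]of_circleK !fphi -[rho1 g](@bsectionK _ s) !descendE.
    exact: cst.
  case: fpf; exists (phi (to_circle 0)) => h.
  by rewrite -[LHS]/((rho1 h \o phi) _) eqv /= phic.
pose n g := projT1 (cid (hn g)).
have nE g x : s (rho1 g) (f x) = f (s (rho2 g) x) + (n g)%:~R.
  by rewrite /n; case: cid.
exists n.
  (* With [k] the floor of [f 0], both [s (rho1 g) (f 0)] and [f (s (rho2 g) 0)] lie in
     [[k, k + 2]]. *)
  exists 2 => g; rewrite -(ler_int R) intr_norm ler_norml.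
  have n0 := nE g 0.
  have /andP[l1 r1] := normalized_sectionE (rho1 g).
  have /andP[/fle l2 /ltW/fle r2] := normalized_sectionE (rho2 g).
  have f1E := f1 0; rewrite add0r in f1E.
  have /andP[fl /ltW fr] := floor_itv (f 0).
  have sl := fl; rewrite -(line_homeo_mono (s (rho1 g))) line_homeo_int in sl.
  have sr := fr; rewrite -(line_homeo_mono (s (rho1 g))) line_homeo_int in sr.
  by rewrite !intrD in fr sr; apply/andP; split; lra.
move=> g h.
(* Adding the cochain value splits [s (rho1 (g * h))] into two factors; moving [f] past them one at
   a time produces [n h] and [n g]. *)
have := nE (g * h)%g 0.
move/(congr1 (fun x => x + (euler_cochain s (rho1 g, rho1 h))%:~R)).
rewrite -normalized_sectionM nE line_homeoDz nE normalized_sectionM fz.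
move=> e; apply/eqP; rewrite -(eqr_int R) !(intrB, intrD); apply/eqP.
by lra.
Qed.

Lemma euler_left_semi_conjugate rho1 rho2 :
  bounded_euler_class rho1 = bounded_euler_class rho2 ->
  left_semi_conjugate rho1 rho2.
Proof.
move=> /bounded_euler_class_eqP[b [M bM] bE].
(* Shifting the second family of lifts by [b] gives it the cocycle of the first, which is [t2M]. *)
pose t1 g := s (rho1 g); pose t2 g x : R := s (rho2 g) x + (b g)%:~R.
have t2le g x y : x <= y -> t2 g x <= t2 g y.
  by move=> xy; rewrite lerD2r line_homeo_mono.
have t2M g h x : t2 g (t2 h x) =
    t2 (g * h)%g x + (euler_cochain s (rho1 g, rho1 h))%:~R.
  rewrite /t2 line_homeoDz normalized_sectionM.
  have /(congr1 (fun n : int => n%:~R : R)) := bE g h.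
  by rewrite !(intrB, intrD) => *; lra.
pose A x := [set y | exists g, y = homeo_inv (t1 g) (t2 g x)]%classic.
have A_le x K : ubound (A x) K <-> forall g, t2 g x <= t1 g K.
  split=> [AK g|AK _ [g ->]].
    by rewrite -[t2 g x](@homeo_invK _ (t1 g)) line_homeo_mono; apply: AK; exists g.
  by rewrite -(line_homeo_mono (t1 g)) homeo_invK.
have A_sup x : has_sup (A x).
  split; first by exists (homeo_inv (t1 1%g) (t2 1%g x)); exists 1%g.
  (* [M] bounds [b g], and the [1] absorbs [s (rho2 g) 0 < 1]. *)
  exists (Num.ceil x + M + 1)%:~R; apply/A_le => g.
  rewrite /t1 /t2 line_homeo_int.
  have /andP[l1 r1] := normalized_sectionE (rho1 g).
  have /andP[l2 r2] := normalized_sectionE (rho2 g).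
  have xc : s (rho2 g) x <= s (rho2 g) 0 + (Num.ceil x)%:~R.
    by rewrite -line_homeo_int line_homeo_mono ceil_ge.
  have : (b g)%:~R <= M%:~R :> R by rewrite ler_int (le_trans (ler_norm _)).
  by rewrite !intrD => *; lra.
pose f x := sup (A x).
have f_le x K : f x <= K <-> forall g, t2 g x <= t1 g K.
  rewrite -A_le; split=> [fK y Ay|AK]; last by apply: ge_sup => //; case: (A_sup x).
  by apply: le_trans fK; apply: ub_le_sup => //; case: (A_sup x).
(* Through [f_le], identities for the supremum reduce to comparing upper bounds. *)
have eq_le (x y : R) : (forall K, x <= K <-> y <= K) -> x = y.
  by move=> xy; apply/le_anti/andP; split; apply/xy.
have fle : {homo f : x y / x <= y}.
  move=> x y xy; apply/f_le => g; apply: le_trans (t2le g _ _ xy) _.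
  by move: g; apply/f_le.
have f1 x : f (x + 1) = f x + 1.
  apply: eq_le => K; rewrite -lerBrDr !f_le.
  have E g : (t2 g (x + 1) <= t1 g K) = (t2 g x <= t1 g (K - 1)).
    by rewrite /t2 -[K in LHS](subrK 1) !line_homeo1 addrAC lerD2r.
  by split=> + g => /(_ g); rewrite E.
have fz := translate_int f1.
have feqv h x : f (t2 h x) = t1 h (f x).
  apply: eq_le => K.
  have -> : (t1 h (f x) <= K) = (f x <= homeo_inv (t1 h) K).
    by rewrite -[in RHS](line_homeo_mono (t1 h)) homeo_invK.
  rewrite !f_le.
  (* The shared cocycle value appears on both sides and cancels. *)
  have E g : (t2 g (t2 h x) <= t1 g K) =
             (t2 (g * h)%g x <= t1 (g * h)%g (homeo_inv (t1 h) K)).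
    by rewrite t2M -[in LHS](@homeo_invK _ (t1 h) K) normalized_sectionM lerD2r.
  split=> le g; last by rewrite E.
  (* Right multiplication by [h] reaches every element of the group. *)
  by rewrite -[g](mulgVK h) -E.
have tcf x : to_circle (f (of_circle (to_circle x))) = to_circle (f x).
  have /to_circle_eqP[n ->] : to_circle (of_circle (to_circle x)) = to_circle x.
    by rewrite of_circleK.
  by rewrite fz to_circleDz.
exists (fun u => to_circle (f (of_circle u))); first by exists f.
move=> g; apply/funext => u /=; rewrite -[u]of_circleK.
rewrite tcf -[rho1 g](@bsectionK _ s) -[rho2 g](@bsectionK _ s) !descendE tcf.
(* The integer shift [b g] disappears on the circle. *)
by rewrite -[s (rho1 g)]/(t1 g) -feqv /t2 fz to_circleDz.
Qed.

End EulerSemiConj.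

Theorem corollary1p6 (R : realType) (Gam : groupType)
    (rho1 rho2 : {multiplicative Gam -> circle_homeo R})
    (fpf1 : fixed_point_free rho1) (fpf2 : fixed_point_free rho2) :
  [<-> semi_conjugate rho1 rho2;
       left_semi_conjugate rho1 rho2;
       right_semi_conjugate rho1 rho2;
       bounded_euler_class rho1 = bounded_euler_class rho2].
Proof.
(* Equality of Euler classes is symmetric in the two actions, so passing through it reverses a
   semi-conjugacy. *)
tfae=> [[]//|/(left_semi_conjugate_euler fpf1) eu|rsc|eu].
- exact: euler_left_semi_conjugate.
- exact/esym/left_semi_conjugate_euler.
- by split; apply: euler_left_semi_conjugate.
Qed.
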